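(* The clique number $\omega$ and the chromatic number $\chi$ are sandwich functions, and every sandwich function $\Phi$ satisfies \[ \omega(G)\le\Phi(G)\le\chi(G) \] for all graphs $G$ with finite chromatic number.
   Context: Graphs are loopless, undirected, and possibly infinite. Let $\mathbb{G}$ be the category whose objects are graphs with finite chromatic number and whose morphisms are graph homomorphisms. The join $G*H$ has vertex set the disjoint union of $V(G)$ and $V(H)$, and its edges are all edges of $G$ and $H$ together with all pairs $xy$ with $x\in V(G)$, $y\in V(H)$. A sandwich function is a function $\Phi$ from objects of $\mathbb{G}$ to nonnegative real numbers such that: (1) $\Phi(\emptyset)=0$ for the empty graph, and $\Phi(G)=1$ if $G$ consists of a single vertex; (2) if there is a morphism $G\to G'$ in $\mathbb{G}$, then $\Phi(G)\le\Phi(G')$; (3) $\Phi(G*G')=\Phi(G)+\Phi(G')$ for all $G,G'$. *)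

(* Defs.v *)
From mathcomp Require Import all_boot all_order all_algebra.
From mathcomp Require Import boolp classical_sets functions cardinality reals.

Set Implicit Arguments.
Unset Strict Implicit.
Unset Printing Implicit Defensive.

Import Order.TTheory GRing.Theory Num.Theory.

Local Open Scope classical_set_scope.
Local Open Scope card_scope.
Local Open Scope ring_scope.

Record graph := Graph {
  vertex :> Type;
  adj : vertex -> vertex -> Prop;
  adj_sym : forall x y, adj x y -> adj y x;
  adj_irr : forall x, ~ adj x x }.

Definition is_hom (G H : graph) (f : G -> H) : Prop :=
  forall x y, adj x y -> adj (f x) (f y).

Definition proper_coloring (G : graph) (k : nat) (c : G -> 'I_k) : Prop :=
  forall x y, adj x y -> c x <> c y.

Definition colorable (G : graph) (k : nat) : Prop :=
  exists c : G -> 'I_k, proper_coloring c.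

Definition clique (G : graph) (K : set G) : Prop :=
  forall x y, K x -> K y -> x <> y -> adj x y.

Definition has_clique (G : graph) (k : nat) : Prop :=
  exists2 K : set G, clique K & K #= `I_k.

Record fcgraph := FCGraph {
  fcgraph_graph :> graph;
  fcgraph_colorable : exists k, colorable fcgraph_graph k }.

Definition join_adj (G H : graph) (u v : G + H) : Prop :=
  match u, v with
  | inl x, inl y => adj x y
  | inr x, inr y => adj x y
  | _, _ => True
  end.

Lemma join_adj_sym (G H : graph) (u v : G + H) :
  join_adj u v -> join_adj v u.
Proof. by case: u => x; case: v => y //=; apply: adj_sym. Qed.

Lemma join_adj_irr (G H : graph) (u : G + H) : ~ join_adj u u.
Proof. by case: u => x /=; apply: adj_irr. Qed.

Definition graph_join (G H : graph) : graph :=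
  Graph (@join_adj_sym G H) (@join_adj_irr G H).

Lemma graph_join_colorable (G H : graph) :
  (exists k, colorable G k) -> (exists k, colorable H k) ->
  exists k, colorable (graph_join G H) k.
Proof.
move=> [m [c cP]] [n [d dP]]; exists (m + n)%N.
exists (fun u : graph_join G H =>
  match u with inl x => lshift n (c x) | inr y => rshift m (d y) end).
case=> x [] y /= xy.
- by move/lshift_inj; apply: cP.
- by apply/eqP; rewrite eq_lrshift.
- by apply/eqP; rewrite eq_rlshift.
- by move/rshift_inj; apply: dP.
Qed.

Definition join (G H : fcgraph) : fcgraph :=
  FCGraph (graph_join_colorable (fcgraph_colorable G) (fcgraph_colorable H)).

Lemma fcgraph_exists_colorable (G : fcgraph) : exists k, `[< colorable G k >].
Proof. by have [k Gk] := fcgraph_colorable G; exists k; apply/asboolP. Qed.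

Definition chi (G : fcgraph) : nat := ex_minn (fcgraph_exists_colorable G).

(* The maximum defining omega below exists because
   the empty clique is a clique, and because a coloring is injective on a
   clique. *)

Lemma fcgraph_exists_clique (G : fcgraph) : exists k, `[< has_clique G k >].
Proof.
exists 0%N; apply/asboolP; exists set0 => //.
by rewrite II0; apply: card_eq00.
Qed.

Lemma has_clique_le (G : graph) (m n : nat) :
  has_clique G m -> colorable G n -> (m <= n)%N.
Proof.
move=> [K Kclique Km] [c cP]; rewrite -card_le_II.
have cinj : {in K &, injective (fun x => c x : nat)}.
  move=> x y /set_mem Kx /set_mem Ky cxy.
  have [//|xy] := pselect (x = y).
  by case: (cP x y (Kclique _ _ Kx Ky xy)); apply: val_inj.
apply: (@card_le_trans _ _ _ ((fun x => c x : nat) @` K)).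
  have /card_eqPle[] := card_eq_trans (inj_card_eq cinj) Km.
  by [].
by apply: subset_card_le => _ [x _ <-] /=.
Qed.

Lemma has_clique_le_chi (G : fcgraph) (k : nat) :
  `[< has_clique G k >] -> (k <= chi G)%N.
Proof.
move=> /asboolP Gk; rewrite /chi; case: ex_minnP => n /asboolP Gn _.
exact: has_clique_le Gk Gn.
Qed.

Definition omega (G : fcgraph) : nat :=
  ex_maxn (fcgraph_exists_clique G) (@has_clique_le_chi G).

Record sandwich (R : realType) (Phi : fcgraph -> R) : Prop := Sandwich {
  sandwich_ge0 : forall G, 0 <= Phi G;
  sandwich_empty : forall G : fcgraph, [set: G] = set0 -> Phi G = 0;
  sandwich_point : forall G : fcgraph,
    (exists x, [set: G] = [set x]) -> Phi G = 1;
  sandwich_hom : forall G G' : fcgraph,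
    (exists f : G -> G', is_hom f) -> Phi G <= Phi G';
  sandwich_join : forall G G', Phi (join G G') = Phi G + Phi G' }.

(* Main.v *)
Require Import Defs.
From mathcomp Require Import all_boot all_order all_algebra reals.
From mathcomp Require Import boolp classical_sets functions cardinality.

Set Implicit Arguments.
Unset Strict Implicit.
Unset Printing Implicit Defensive.

Import Order.TTheory GRing.Theory Num.Theory.

Local Open Scope ring_scope.

(** Cliques and colorings are homomorphisms from and to complete graphs, so both
bounds follow by monotonicity once [Phi (complete n) = n], and this holds
because [complete n.+1] is homomorphically equivalent to the join of
[complete 1] and [complete n].  For the additivity of [omega] and [chi], a
clique of a join is split according to the two sides, and so are the colors of
a coloring of a join, since no color is used on both sides. *)

Definition complete_graph (n : nat) : graph :=
  @Graph 'I_n (fun i j => i <> j) (fun i j ij ji => ij (esym ji))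
    (fun i ii => ii erefl).

Lemma complete_graph_colorable n : exists k, colorable (complete_graph n) k.
Proof. by exists n, id. Qed.

Definition complete (n : nat) : fcgraph :=
  FCGraph (complete_graph_colorable n).

Lemma colorable_hom (G G' : graph) (f : G -> G') k :
  is_hom f -> colorable G' k -> colorable G k.
Proof. by move=> fP [c cP]; exists (c \o f) => x y /fP /cP. Qed.

Lemma colorableP (G : graph) k :
  colorable G k <-> exists f : G -> complete k, is_hom f.
Proof. by split=> -[f fP]; exists f. Qed.

(** Enumerating a [k]-clique by ['I_k] sends distinct indices to distinct, hence adjacent, vertices.
    Conversely, a homomorphism from [complete k] is injective because [G] has no loops, so its range
    has exactly [k] elements. *)
Lemma has_cliqueP (G : graph) k :
  has_clique G k <-> exists f : complete k -> G, is_hom f.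
Proof.
split=> [[K Kcl Kk]|[f fP]].
  have /card_bijP[g /bij_inj ginj] : ([set: 'I_k]%classic #= K)%card.
    exact: card_eq_trans (card_esym card_II) (card_esym Kk).
  (* [g] is a bijection between the sets seen as subtypes; [h] only moves its domain back to
     ['I_k]. *)
  pose h (i : 'I_k) := g (SigSub (mem_set (I : [set: 'I_k]%classic i))).
  exists (fun i => val (h i)) => i j ij.
  apply: Kcl; [exact: set_mem (valP _)..|].
  by move=> /val_inj /ginj /(congr1 val).
have finj : injective f.
  move=> i j fij; apply: contrapT => /(fP i j).
  by rewrite fij; apply: adj_irr.
exists (range f).
  by move=> _ _ [i _ <-] [j _ <-] fij; apply: fP => ij; apply: fij; rewrite ij.
apply: (@card_eq_trans _ _ _ _ [set: 'I_k]%classic).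
  by apply: inj_card_eq => i j _ _; apply: finj.
exact/card_esym/card_II.
Qed.

Lemma has_clique_hom (G G' : graph) (f : G -> G') k :
  is_hom f -> has_clique G k -> has_clique G' k.
Proof.
move=> fP /has_cliqueP[g gP]; apply/has_cliqueP.
by exists (f \o g) => x y /gP /fP.
Qed.

Lemma colorable_widen (G : graph) m n :
  (m <= n)%N -> colorable G m -> colorable G n.
Proof.
move=> mn [c cP]; exists (widen_ord mn \o c) => x y /cP cxy /(congr1 val) /= e.
exact/cxy/val_inj.
Qed.

Lemma has_clique_widen (G : graph) m n :
  (m <= n)%N -> has_clique G n -> has_clique G m.
Proof.
move=> mn /has_cliqueP[f fP]; apply/has_cliqueP.
exists (f \o widen_ord mn) => i j ij; apply: fP => /(congr1 val) /= e.
exact/ij/val_inj.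
Qed.

(** Colorability is upward closed in [k], so the minimum is a threshold; [omega_geP] is the dual
    fact for cliques. *)
Lemma chi_leP (G : fcgraph) k : (chi G <= k)%N <-> colorable G k.
Proof.
rewrite /chi; case: ex_minnP => n /asboolP Gn n_min; split.
  by move=> /colorable_widen; apply.
by move=> Gk; apply: n_min; apply/asboolP.
Qed.

Lemma omega_geP (G : fcgraph) k : (k <= omega G)%N <-> has_clique G k.
Proof.
rewrite /omega; case: ex_maxnP => n /asboolP Gn n_max; split.
  by move=> /has_clique_widen; apply.
by move=> Gk; apply: n_max; apply/asboolP.
Qed.

Lemma omega_le_chi (G : fcgraph) : (omega G <= chi G)%N.
Proof. by apply: (@has_clique_le G); [apply/omega_geP|apply/chi_leP]. Qed.

Lemma chi_empty (G : fcgraph) : [set: G]%classic = set0 -> chi G = 0%N.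
Proof.
move=> G0; have noG (x : G) : False by have : set0 x by rewrite -G0.
apply/eqP; rewrite -leqn0; apply/chi_leP.
by exists (fun x => False_rect _ (noG x)) => x; case: (noG x).
Qed.

(** The upper bound suffices: with [omega_inhabited] and [omega_le_chi] it squeezes both invariants
    to 1. *)
Lemma chi_point (G : fcgraph) :
  (exists x, [set: G] = [set x])%classic -> (chi G <= 1)%N.
Proof.
move=> [x0 Gx0]; have Gx (x : G) : x = x0.
  by have : [set x0]%classic x by rewrite -Gx0.
apply/chi_leP; exists (fun=> ord0) => x y.
by rewrite (Gx x) (Gx y) => /adj_irr.
Qed.

Lemma omega_inhabited (G : fcgraph) (x : G) : (1 <= omega G)%N.
Proof.
by apply/omega_geP/has_cliqueP; exists (fun=> x) => i j; rewrite !ord1.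
Qed.

Lemma join_hom (G G' H H' : graph) (f : G -> G') (g : H -> H') :
  is_hom f -> is_hom g ->
  @is_hom (graph_join G H) (graph_join G' H')
    (fun u => match u with inl x => inl (f x) | inr y => inr (g y) end).
Proof. by move=> fP gP [x|x] [y|y] //=; [apply: fP|apply: gP]. Qed.

Lemma join_complete_hom m n :
  @is_hom (graph_join (complete m) (complete n)) (complete (m + n))
    (@unsplit m n).
Proof.
move=> u v uv /(can_inj (@unsplitK m n)) e.
by move: uv; rewrite e; apply: adj_irr.
Qed.

Lemma complete_join_hom m n :
  @is_hom (complete (m + n)) (graph_join (complete m) (complete n))
    (@fintype.split m n).
Proof.
move=> i j ij; have : fintype.split i <> fintype.split j.
  by move/(can_inj splitK).
by case: (fintype.split i) (fintype.split j) => [x|x] [y|y] //= xy e;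
  case: xy; rewrite e.
Qed.

(** Renumbering the colors by their rank in [A] lets one count only the colors available to one side
    of a join. *)
Lemma colorable_card (G : graph) (T : finType) (A : {set T}) (c : G -> T) :
  (forall x, c x \in A) -> (forall x y, adj x y -> c x <> c y) ->
  colorable G #|A|.
Proof.
move=> cA cP; exists (fun x => enum_rank_in (cA x) (c x)) => x y /cP cxy.
by move=> /(congr1 enum_val); rewrite !enum_rankK_in.
Qed.

(** A relation [r] is used because the clique of a join meets one side only for some indices; choice
    turns it into a function on [A]. *)
Lemma has_clique_card (G : graph) (T : finType) (A : {set T})
    (r : T -> G -> Prop) :
  (forall i, i \in A -> exists x, r i x) ->
  (forall i j x y, i <> j -> r i x -> r j y -> adj x y) ->
  has_clique G #|A|.
Proof.
move=> rA rP; apply/has_cliqueP.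
have [f fP] := choice (fun i : 'I_#|A| => rA _ (enum_valP i)).
by exists f => i j ij; apply: rP (fP i) (fP j) => /enum_val_inj.
Qed.

Lemma chi_join (G H : fcgraph) : chi (join G H) = (chi G + chi H)%N.
Proof.
apply/eqP; rewrite eqn_leq; apply/andP; split.
  have [/colorableP[c cP] /colorableP[d dP]] :
    colorable G (chi G) /\ colorable H (chi H) by split; apply/chi_leP.
  apply/chi_leP/(colorable_hom (join_hom cP dP)).
  by apply/colorableP; exists (@unsplit _ _); apply: join_complete_hom.
have /chi_leP[c cP] := leqnn (chi (join G H)).
(* [A] holds the colors used on [G]. Every vertex of [H] is adjacent to all of [G], so its color
   lies in the complement, and the two cardinals add up to [chi (join G H)]. *)
pose A := [set i | `[< exists x : G, c (inl x) = i >]].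
rewrite -[chi (join G H)]card_ord -(cardsC A) leq_add //; apply/chi_leP.
  apply: (@colorable_card _ _ _ (c \o inl)) => [x|x y xy].
    by rewrite inE; apply/asboolP; exists x.
  exact: (cP (inl x) (inl y)).
apply: (@colorable_card _ _ _ (c \o inr)) => [y|x y xy].
  by rewrite !inE; apply/asboolPn => -[x]; apply: (cP (inl x) (inr y)).
exact: (cP (inr x) (inr y)).
Qed.

Lemma omega_join (G H : fcgraph) : omega (join G H) = (omega G + omega H)%N.
Proof.
apply/eqP; rewrite eqn_leq; apply/andP; split; last first.
  have [/has_cliqueP[f fP] /has_cliqueP[g gP]] :
    has_clique G (omega G) /\ has_clique H (omega H) by split; apply/omega_geP.
  apply/omega_geP/(has_clique_hom (join_hom fP gP)).
  by apply/has_cliqueP; exists (@fintype.split _ _); apply: complete_join_hom.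
have /omega_geP/has_cliqueP[f fP] := leqnn (omega (join G H)).
(* [A] indexes the clique vertices lying in [G]; its complement indexes those in [H]. *)
pose A := [set i : 'I__ | if f i is inl _ then true else false].
rewrite -[omega (join G H)]card_ord -(cardsC A) leq_add //; apply/omega_geP.
  apply: (@has_clique_card _ _ _ (fun i x => f i = inl x)) => [i|i j x y ij].
    by rewrite inE; case: (f i) => // x _; exists x.
  by move=> fi fj; have := fP i j ij; rewrite fi fj.
apply: (@has_clique_card _ _ _ (fun i x => f i = inr x)) => [i|i j x y ij].
  by rewrite !inE; case: (f i) => // x _; exists x.
by move=> fi fj; have := fP i j ij; rewrite fi fj.
Qed.

Lemma sandwich_omega (R : realType) :
  sandwich (fun G : fcgraph => (omega G)%:R : R).
Proof.
split=> [G|G G0|G [x Gx]|G G' [f fP]|G G'].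
- exact: ler0n.
(* An empty graph has no coloring obstruction, so [omega] is bounded by [chi], which is 0. *)
- by have := omega_le_chi G; rewrite chi_empty // leqn0 => /eqP ->.
- suff -> : omega G = 1%N by [].
  apply/eqP; rewrite eqn_leq omega_inhabited // andbT.
  by apply: leq_trans (omega_le_chi G) _; apply: chi_point; exists x.
- by rewrite ler_nat; apply/omega_geP/(has_clique_hom fP)/omega_geP.
- by rewrite omega_join natrD.
Qed.

Lemma sandwich_chi (R : realType) :
  sandwich (fun G : fcgraph => (chi G)%:R : R).
Proof.
split=> [G|G G0|G [x Gx]|G G' [f fP]|G G'].
- exact: ler0n.
- by rewrite chi_empty.
- suff -> : chi G = 1%N by [].
  apply/eqP; rewrite eqn_leq (leq_trans _ (omega_le_chi G)) ?omega_inhabited//.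
  by rewrite andbT; apply: chi_point; exists x.
- by rewrite ler_nat; apply/chi_leP/(colorable_hom fP)/chi_leP.
- by rewrite chi_join natrD.
Qed.

Lemma sandwich_complete (R : realType) (Phi : fcgraph -> R) n :
  sandwich Phi -> Phi (complete n) = n%:R.
Proof.
move=> PhiP; elim: n => [|n IHn].
  by apply: (sandwich_empty PhiP); apply/seteqP; split=> // -[].
have Phi1 : Phi (complete 1) = 1.
  apply: (sandwich_point PhiP); exists (ord0 : 'I_1).
  by apply/seteqP; split=> // i _; apply: ord1.
rewrite -add1n natrD -IHn -[1%:R]Phi1 -(sandwich_join PhiP).
apply/eqP; rewrite eq_le; apply/andP; split; apply: (sandwich_hom PhiP).
  by exists (@fintype.split 1 n); apply: complete_join_hom.
by exists (@unsplit 1 n); apply: join_complete_hom.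
Qed.

Theorem proposition3p3 (R : realType) :
  [/\ sandwich (fun G : fcgraph => (omega G)%:R : R),
      sandwich (fun G : fcgraph => (chi G)%:R : R)
    & forall Phi : fcgraph -> R, sandwich Phi ->
      forall G : fcgraph, (omega G)%:R <= Phi G <= (chi G)%:R].
Proof.
split=> [||Phi PhiP G]; [exact: sandwich_omega|exact: sandwich_chi|].
(* Both bounds become values of [Phi] on complete graphs, leaving homomorphisms from
   [complete (omega G)] to [G] and from [G] to [complete (chi G)]. *)
rewrite -!(sandwich_complete _ PhiP); apply/andP.
split; apply: (sandwich_hom PhiP).
  by apply/has_cliqueP/omega_geP.
by apply/colorableP/chi_leP.
Qed.
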